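(* Let $r\ge1$ and $n\ge2r$. The higher-order U-centering operator $\mathcal U_{n,r}$ is the orthogonal projection of $\mathcal V_{n,r}$ onto the residual space $\mathcal H_{n,r}=\ker(D_{r-1,r})$. Equivalently, for every $A\in\mathcal V_{n,r}$, $\mathcal U_{n,r}A$ is the least-squares residual obtained after fitting every ANOVA effect involving fewer than $r$ labels, i.e. after fitting the model $A_I=\sum_{j=0}^{r-1}\sum_{J\subseteq I,\,|J|=j}\alpha_J+\varepsilon_I$ with free real parameters $\alpha_J$ ($J\subseteq[n]$, $|J|\le r-1$). In particular: 1. $D_{r-1,r}(\mathcal U_{n,r}A)=0$ for every $A\in\mathcal V_{n,r}$; 2. $\mathcal U_{n,r}A=A$ for every $A\in\mathcal H_{n,r}$; 3. $\mathcal U_{n,r}$ is self-adjoint and idempotent; 4. $\ker(\mathcal U_{n,r})=\mathcal L_{n,r}$; and 5. the residual degrees of freedom are $$d_{n,r}:=\dim(\mathcal H_{n,r})=\binom nr-\binom n{r-1}=\binom nr\frac{n-2r+1}{n-r+1}.$$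
   Context: Let $[n]=\{1,\dots,n\}$, let $\binom{[n]}j$ be the set of $j$-element subsets of $[n]$ (with $\binom{[n]}0=\{\varnothing\}$), $\mathcal I_{n,r}=\binom{[n]}r$, and $\mathcal V_{n,r}=\mathbb R^{\mathcal I_{n,r}}$ with inner product $\langle A,B\rangle=\sum_{I\in\mathcal I_{n,r}}A_IB_I$. For $0\le j\le r$ the margin map $D_{j,r}:\mathcal V_{n,r}\to\mathbb R^{\binom{[n]}j}$ is $(D_{j,r}A)(J)=\sum_{I\in\mathcal I_{n,r},\,I\supseteq J}A_I$, with adjoint $(D_{j,r}^*f)(I)=\sum_{J\subseteq I,\,|J|=j}f(J)$. The lower-order ANOVA space is $\mathcal L_{n,r}=\operatorname{range}(D_{r-1,r}^* )$. Higher-order U-centering is the linear operator on $\mathcal V_{n,r}$ $$\mathcal U_{n,r}A=\sum_{j=0}^r c_{n,r,j}D_{j,r}^*D_{j,r}A,\qquad c_{n,r,j}=\frac{(-1)^{r-j}}{\binom{n-r-j+1}{r-j}}.$$ *)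

(* Defs.v *)
From HB Require Import structures.
From mathcomp Require Import all_boot all_order all_algebra.
From mathcomp Require Import reals.

Set Implicit Arguments.
Unset Strict Implicit.
Unset Printing Implicit Defensive.

Import Order.TTheory GRing.Theory Num.Theory.
Local Open Scope ring_scope.

(* [n] is represented by 'I_n = {0, ..., n-1}. *)
Notation layer n j := {J : {set 'I_n} | #|J| == j}.

(* R^o is R seen as a module over itself; it gives real functions on a finite
   type their structure of finite-dimensional R-vector space. *)
Notation rfun R T := {ffun T -> R^o}.

Notation V R n j := (rfun R (layer n j)).

Definition dot (R : realType) (T : finType) (A B : rfun R T) : R :=
  \sum_(I : T) A I * B I.

Section MarginMaps.
Variables (R : realType) (n j r : nat).

Definition margin_fun (A : V R n r) : V R n j :=
  [ffun J : layer n j =>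
     \sum_(I : layer n r | val J \subset val I) A I].

Definition margin_adj_fun (f : V R n j) : V R n r :=
  [ffun I : layer n r =>
     \sum_(J : layer n j | val J \subset val I) f J].

Lemma margin_fun_is_linear : linear margin_fun.
Proof.
move=> a A B; apply/ffunP => J; rewrite !ffunE scaler_sumr -big_split /=.
by apply: eq_bigr => I _; rewrite !ffunE.
Qed.

Lemma margin_adj_fun_is_linear : linear margin_adj_fun.
Proof.
move=> a f g; apply/ffunP => I; rewrite !ffunE scaler_sumr -big_split /=.
by apply: eq_bigr => J _; rewrite !ffunE.
Qed.

HB.instance Definition _ :=
  GRing.isLinear.Build R (V R n r) (V R n j) *:%R margin_fun
    margin_fun_is_linear.

HB.instance Definition _ :=
  GRing.isLinear.Build R (V R n j) (V R n r) *:%R margin_adj_fun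
    margin_adj_fun_is_linear.

Definition margin : 'Hom(V R n r, V R n j) := linfun margin_fun.

Definition margin_adj : 'Hom(V R n j, V R n r) := linfun margin_adj_fun.

Lemma marginE (A : V R n r) (J : layer n j) :
  margin A J = \sum_(I : layer n r | val J \subset val I) A I.
Proof. by rewrite lfunE ffunE. Qed.

Lemma margin_adjE (f : V R n j) (I : layer n r) :
  margin_adj f I = \sum_(J : layer n j | val J \subset val I) f J.
Proof. by rewrite lfunE ffunE. Qed.

Lemma margin_adjP (A : V R n r) (f : V R n j) :
  dot (margin A) f = dot A (margin_adj f).
Proof.
rewrite /dot; under eq_bigr do rewrite marginE mulr_suml.
under [RHS]eq_bigr do rewrite margin_adjE mulr_sumr.
by rewrite (exchange_big_dep xpredT).
Qed.

End MarginMaps.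

Definition ANOVA_space (R : realType) (n r : nat) : {vspace V R n r} :=
  limg (margin_adj R n r.-1 r).

Definition residual_space (R : realType) (n r : nat) : {vspace V R n r} :=
  lker (margin R n r.-1 r).

(* The subtractions on nat are exact when j <= r and 2 * r <= n. *)
Definition Ucoef (R : realType) (n r j : nat) : R :=
  (-1) ^+ (r - j) / 'C(n - r - j + 1, r - j)%:R.

Definition Ucenter (R : realType) (n r : nat) : 'End(V R n r) :=
  \sum_(j < r.+1) Ucoef R n r j *: (margin_adj R n j r \o margin R n j r)%VF.

Definition orthogonal_projection (R : realType) (T : finType)
    (P : 'End(rfun R T)) (W : {vspace rfun R T}) : Prop :=
  forall A : rfun R T,
    P A \in W /\ (forall B : rfun R T, B \in W -> dot (A - P A) B = 0).

(* Parameters alpha_J of the ANOVA model: one for each J with |J| < r. *)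
Notation effects R n r := (rfun R {J : {set 'I_n} | (#|J| < r)%N}).

Definition ANOVA_fit (R : realType) (n r : nat) (alpha : effects R n r) :
    V R n r :=
  [ffun I : layer n r =>
     \sum_(j < r) \sum_(J : {J : {set 'I_n} | (#|J| < r)%N} |
                        (val J \subset val I) && (#|val J| == j)) alpha J].

(* E is a residual A - fit(alpha) for some alpha that minimizes the residual
   sum of squares over all parameters. *)
Definition least_squares_residual (R : realType) (n r : nat)
    (A E : V R n r) : Prop :=
  exists alpha : effects R n r,
    (forall beta : effects R n r,
       dot (A - ANOVA_fit alpha) (A - ANOVA_fit alpha)
         <= dot (A - ANOVA_fit beta) (A - ANOVA_fit beta))
    /\ E = A - ANOVA_fit alpha.

(* Main.v *)
(* In the delta basis, U A (I) is the sum over I0 of u(|I :&: I0|) A(I0), where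
   u = Ukernel.  Summing over the r-sets I that contain an (r-1)-set K with
   |K :&: I0| = t gives (r - t) u(t+1) + (n - 2r + 1 + t) u(t) = 0, so U takes
   values in the residual space H.  Every D_j^* with j < r factors through
   D_{r-1}^*, and the j = r term of U is the identity, so A - U A lies in the
   ANOVA space L.  As H and L are orthogonal, this determines U as the orthogonal
   projection onto H along L.  The dimension of L is that of the (r-1)-layer:
   with s = r - 1, D_s D_s^* = (n - 2s) id + D_{s-1}^* D_{s-1}, where D_s goes
   from layer s+1 to layer s, is positive definite, hence D_s^* is injective. *)
Require Import Defs.
From HB Require Import structures.
From mathcomp Require Import all_boot all_order all_algebra.
From mathcomp Require Import reals ring zify.

Set Implicit Arguments.
Unset Strict Implicit.
Unset Printing Implicit Defensive.

Import Order.TTheory GRing.Theory Num.Theory.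
Local Open Scope ring_scope.

(** * Sums over the sets obtained by adding or deleting one point *)

Section SumsOverSets.
Variables (M : nmodType) (T : finType).

Lemma sum_sigma (P Q : pred T) (F : T -> M) :
  \sum_(x : {x | P x} | Q (val x)) F (val x) = \sum_(x | P x && Q x) F x.
Proof. exact: (esym (big_sub_cond P Q F)). Qed.

Lemma sum_setU1 (K : {set T}) (F : {set T} -> M) :
  \sum_(I : {set T} | (#|I| == #|K|.+1) && (K \subset I)) F I
    = \sum_(x in ~: K) F (x |: K).
Proof.
have inj : {in ~: K &, injective (fun x => x |: K)}.
  move=> x y; rewrite !inE => xK yK /setP/(_ x).
  by rewrite !inE eqxx (negPf xK) !orbF => /esym/eqP.
rewrite -(big_imset _ inj); apply: eq_bigl => I; apply/andP/imsetP.
- case=> /eqP cI KI.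
  have /eqP/cards1P[x Ix] : #|I :\: K| = 1%N.
    by rewrite cardsD (setIidPr KI) cI subSnn.
  have /setDP[xI xK] : x \in I :\: K by rewrite Ix set11.
  exists x; first by rewrite ?inE.
  by rewrite -(setID I K) (setIidPr KI) Ix setUC.
case=> x; rewrite inE => xK ->.
by rewrite cardsU1 xK add1n eqxx subsetUr.
Qed.

Lemma sum_setD1 (I : {set T}) (F : {set T} -> M) :
  \sum_(K : {set T} | (#|K|.+1 == #|I|) && (K \subset I)) F K
    = \sum_(x in I) F (I :\ x).
Proof.
have inj : {in I &, injective (fun x => I :\ x)}.
  move=> x y xI yI /setP/(_ x); rewrite !inE eqxx xI !andbT /=.
  by move=> /esym/negbFE/eqP.
rewrite -(big_imset _ inj); apply: eq_bigl => K; apply/andP/imsetP.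
- case=> /eqP cK KI.
  have /eqP/cards1P[x Ix] : #|I :\: K| = 1%N.
    by rewrite cardsD (setIidPr KI) -cK subSnn.
  have /setDP[xI xK] : x \in I :\: K by rewrite Ix set11.
  exists x; first by rewrite ?inE.
  by rewrite -Ix setDDr setDv set0U (setIidPr KI).
case=> x xI ->.
by rewrite (cardsD1 x I) xI add1n eqxx subsetDl.
Qed.

End SumsOverSets.

(** * Functions on a layer as functions on all sets *)

Section ZeroExtension.
Variables (R : realType) (T : finType) (P : pred T).

(** Allows evaluation at sets such as [x |: K] or [I :\ x] without carrying a cardinality proof in
    the argument. *)
Definition zero_ext (f : rfun R {x | P x}) (x : T) : R := oapp f 0 (insub x).

Lemma zero_ext_val (f : rfun R {x | P x}) (u : {x | P x}) :
  zero_ext f (val u) = f u.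
Proof. by rewrite /zero_ext valK. Qed.

Lemma zero_extT (f : rfun R {x | P x}) (x : T) (Px : P x) :
  zero_ext f x = f (exist _ x Px).
Proof. exact: (zero_ext_val f (exist _ x Px)). Qed.

Lemma zero_extN (f : rfun R {x | P x}) (x : T) : ~~ P x -> zero_ext f x = 0.
Proof. by move=> Px; rewrite /zero_ext insubN. Qed.

Lemma sum_zero_ext (Q : pred T) (f : rfun R {x | P x}) :
  \sum_(u : {x | P x} | Q (val u)) f u = \sum_(x | P x && Q x) zero_ext f x.
Proof.
by rewrite -sum_sigma; apply: eq_bigr => u _; rewrite zero_ext_val.
Qed.

End ZeroExtension.

(** * Margin maps in terms of adding and deleting points *)

Section Margins.
Variables (R : realType) (n : nat).

Lemma margin_zero_ext (j r : nat) (A : V R n r) (J : layer n j) :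
  margin R n j r A J
    = \sum_(I : {set 'I_n} | (#|I| == r) && (val J \subset I)) zero_ext A I.
Proof.
by rewrite marginE (sum_zero_ext (fun I : {set 'I_n} => val J \subset I)).
Qed.

Lemma margin_adj_zero_ext (j r : nat) (f : V R n j) (I : layer n r) :
  margin_adj R n j r f I
    = \sum_(J : {set 'I_n} | (#|J| == j) && (J \subset val I)) zero_ext f J.
Proof.
by rewrite margin_adjE (sum_zero_ext (fun J : {set 'I_n} => J \subset val I)).
Qed.

Lemma margin_setU1 (s : nat) (A : V R n s.+1) (K : layer n s) :
  margin R n s s.+1 A K = \sum_(x in ~: val K) zero_ext A (x |: val K).
Proof.
rewrite margin_zero_ext -sum_setU1; apply: eq_bigl => I.
by rewrite (eqP (valP K)).
Qed.

Lemma margin_adj_setD1 (s : nat) (f : V R n s) (I : layer n s.+1) :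
  margin_adj R n s s.+1 f I = \sum_(x in val I) zero_ext f (val I :\ x).
Proof.
rewrite margin_adj_zero_ext -sum_setD1; apply: eq_bigl => K.
by rewrite (eqP (valP I)) eqSS.
Qed.

(* Each J of size j inside I lies in exactly s + 1 - j of the sets I minus a
   point. *)
Lemma margin_adj_comp (j s : nat) (f : V R n j) : (j <= s.+1)%N ->
  margin_adj R n s s.+1 (margin_adj R n j s f)
    = (s.+1 - j)%:R *: margin_adj R n j s.+1 f.
Proof.
move=> js; apply/ffunP => I; rewrite margin_adj_setD1 ffunE.
rewrite margin_adj_zero_ext scaler_sumr.
have E x : x \in val I -> zero_ext (margin_adj R n j s f) (val I :\ x)
    = \sum_(J : {set 'I_n} | (#|J| == j) && (J \subset val I :\ x))
        zero_ext f J.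
  move=> xI; have c : #|val I :\ x| == s.
    by have := eqP (valP I); rewrite (cardsD1 x) xI add1n => -[->].
  by rewrite zero_extT margin_adj_zero_ext.
rewrite (eq_bigr _ E).
rewrite (exchange_big_dep (fun J : {set 'I_n} => (#|J| == j) && (J \subset val I)))
  /=; last first.
  by move=> x J xI /andP[->]; rewrite subsetD1 => /andP[].
apply: eq_bigr => J /andP[cJ JI].
rewrite (eq_bigl (fun x => x \in val I :\: J)); last first.
  by move=> x; rewrite !inE cJ subsetD1 JI andbC.
rewrite sumr_const cardsD (setIidPr JI) (eqP cJ) (eqP (valP I)).
by rewrite -[RHS]/(_ * _) mulr_natl.
Qed.

End Margins.

(** * The coefficients of U and the recurrence of its kernel *)

Section Kernel.
Variable R : realType.

(** The subtraction is taken in [R], so that the identity also covers [t < j], where both binomials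
    vanish. *)
Lemma natr_mul_bin_left (t j : nat) :
  (j.+1%:R * 'C(t, j.+1)%:R : R) = (t%:R - j%:R) * 'C(t, j)%:R.
Proof.
rewrite -natrM mul_bin_left natrM.
have [tj|jt] := ltnP t j; first by rewrite (bin_small tj) !mulr0.
by rewrite natrB.
Qed.

(** With m = n - r - j and k = r - j - 1, the two coefficients have opposite signs, and clearing
    denominators leaves (m+1) C(m,k) = (k+1) C(m+1,k+1). *)
Lemma Ucoef_rec (n r j : nat) : (2 * r <= n)%N -> (j < r)%N ->
  (n%:R - r%:R + 1 - j%:R) * Ucoef R n r j
    + (r%:R - j%:R) * Ucoef R n r j.+1 = 0.
Proof.
move=> hn jr; rewrite /Ucoef.
set k := (r - j.+1)%N; set m := (n - r - j)%N.
have -> : (n - r - j + 1 = m.+1)%N by rewrite addn1.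
have -> : (n - r - j.+1 + 1 = m)%N by lia.
have -> : (r - j = k.+1)%N by lia.
have Er : r%:R = k.+1%:R + j%:R :> R by rewrite -natrD; congr _%:R; lia.
have En : n%:R = m%:R + r%:R + j%:R :> R by rewrite -!natrD; congr _%:R; lia.
have C1 : ('C(m, k)%:R : R) != 0 by rewrite pnatr_eq0 -lt0n bin_gt0; lia.
have C2 : ('C(m.+1, k.+1)%:R : R) != 0 by rewrite pnatr_eq0 -lt0n bin_gt0; lia.
have : m.+1%:R * 'C(m, k)%:R = k.+1%:R * 'C(m.+1, k.+1)%:R :> R.
  by rewrite -!natrM mul_bin_diag.
rewrite En Er exprS -[in m.+1%:R]natr1 => D.
transitivity ((-1) ^+ k * (k.+1%:R * 'C(m.+1, k.+1)%:R - (m%:R + 1) * 'C(m, k)%:R)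
    / ('C(m, k)%:R * 'C(m.+1, k.+1)%:R) : R); first by field; apply/andP.
by rewrite D subrr mulr0 mul0r.
Qed.

(** Matrix entry of U at two r-sets that share t points: ['C(t, j)] counts the j-sets contained in
    both. *)
Definition Ukernel (n r t : nat) : R :=
  \sum_(j < r.+1) Ucoef R n r j * 'C(t, j)%:R.

(* Pascal's rule and [natr_mul_bin_left] turn the left-hand side into a sum
   that telescopes by [Ucoef_rec]. *)
Lemma Ukernel_rec (n r t : nat) : (2 * r <= n)%N -> (t < r)%N ->
  (r%:R - t%:R) * Ukernel n r t.+1
    + (n%:R - 2 * r%:R + 1 + t%:R) * Ukernel n r t = 0.
Proof.
move=> hn tr; rewrite /Ukernel.
(* After Pascal's rule c_j C(t,j) has weight n - r + 1. Trading j C(t,j) for (t-j+1) C(t,j-1) gives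
   the weight in [p] and the weight r - j of the shifted sum, as in [Ucoef_rec]. *)
pose p (j : nat) := (n%:R - r%:R + 1 - j%:R) * Ucoef R n r j * 'C(t, j)%:R.
transitivity (\sum_(j < r.+1) p j
    + \sum_(j < r) (r%:R - j%:R) * Ucoef R n r j.+1 * 'C(t, j)%:R).
  rewrite !big_ord_recl /=.
  rewrite {1}/p !bin0 !mulrDr.
  set a := Ucoef _ _ _ 0; rewrite !mulr_sumr.
  have -> : \sum_(i < r) (r%:R - i%:R) * Ucoef R n r i.+1 * 'C(t, i)%:R
      = \sum_(i < r) (r%:R - t%:R) * (Ucoef R n r (bump 0 i) * 'C(t.+1, bump 0 i)%:R)
      + \sum_(i < r) (n%:R - 2 * r%:R + 1 + t%:R) * (Ucoef R n r (bump 0 i) * 'C(t, bump 0 i)%:R)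
      - \sum_(i < r) p (bump 0 i).
    rewrite -big_split -sumrB; apply: eq_bigr => i _; rewrite /p /= /bump !add1n.
    rewrite binS natrD -[in (_ - i.+1%:R)]natr1.
    have := natr_mul_bin_left t i; rewrite -natr1 => E.
    apply: subr0_eq; transitivity (Ucoef R n r i.+1
      * ((t%:R - i%:R) * 'C(t, i)%:R - (i%:R + 1) * 'C(t, i.+1)%:R)); first by ring.
    by rewrite E subrr mulr0.
  rewrite /p; ring.
(* The extra term [p r] vanishes because t < r; the others cancel index by index. *)
rewrite big_ord_recr /= /p bin_small // mulr0 addr0 -big_split /=.
apply: big1 => i _; rewrite -mulrDl Ucoef_rec ?mul0r //.
Qed.

End Kernel.

(** * The inner product: bilinearity and definiteness *)

Section DotProduct.
Variables (R : realType) (T : finType).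
Implicit Types A B C : rfun R T.

Lemma dotC A B : dot A B = dot B A.
Proof. by apply: eq_bigr => i _; rewrite mulrC. Qed.

Lemma dotDl A B C : dot (A + B) C = dot A C + dot B C.
Proof. by rewrite /dot -big_split; apply: eq_bigr => i _; rewrite ffunE mulrDl. Qed.

Lemma dotZl a A B : dot (a *: A) B = a * dot A B.
Proof. by rewrite /dot mulr_sumr; apply: eq_bigr => i _; rewrite ffunE mulrA. Qed.

Lemma dotDr A B C : dot A (B + C) = dot A B + dot A C.
Proof. by rewrite ![dot A _]dotC dotDl. Qed.

Lemma dot0l A : dot 0 A = 0.
Proof. by apply: big1 => i _; rewrite ffunE mul0r. Qed.

Lemma dot_ge0 A : 0 <= dot A A.
Proof. by apply: sumr_ge0 => i _; rewrite -expr2 sqr_ge0. Qed.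

Lemma dot_eq0 A : dot A A = 0 -> A = 0.
Proof.
move=> /eqP; rewrite psumr_eq0 => [/allP A0|i _]; last by rewrite -expr2 sqr_ge0.
apply/ffunP => i; rewrite ffunE.
by have /eqP := A0 i (mem_index_enum i); move=> /eqP; rewrite mulf_eq0 orbb => /eqP.
Qed.

End DotProduct.

(** * Gottlieb's theorem for consecutive layers: injectivity of the adjoint margin *)

Section Gottlieb.
Variables (R : realType) (n : nat).

(** Add a point x, then delete a point y: the choice y = x returns K, in n - s ways, and every other
    y lies in K and exchanges a point. *)
Lemma margin_margin_adj_setU1 (s : nat) (f : V R n s) (K : layer n s) :
  margin R n s s.+1 (margin_adj R n s s.+1 f) K
    = (n - s)%:R * f K
      + \sum_(x in ~: val K) \sum_(y in val K) zero_ext f ((x |: val K) :\ y).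
Proof.
have cK := eqP (valP K).
rewrite margin_setU1.
have E x : x \in ~: val K -> zero_ext (margin_adj R n s s.+1 f) (x |: val K)
   = f K + \sum_(y in val K) zero_ext f ((x |: val K) :\ y).
  rewrite inE => xK; have c : #|x |: val K| == s.+1 by rewrite cardsU1 xK cK.
  by rewrite zero_extT margin_adj_setD1 /= big_setU1 //= setU1K // zero_ext_val.
rewrite (eq_bigr _ E) big_split /= sumr_const cardsCs setCK cK card_ord.
by rewrite mulr_natl.
Qed.

(** Delete y first, then add x: putting y back returns K, in s + 1 ways; the remaining choices give
    the same exchange sum as in the other order. *)
Lemma margin_adj_margin_setD1 (s : nat) (f : V R n s.+1) (K : layer n s.+1) :
  margin_adj R n s s.+1 (margin R n s s.+1 f) K
    = s.+1%:R * f K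
      + \sum_(x in ~: val K) \sum_(y in val K) zero_ext f ((x |: val K) :\ y).
Proof.
have cK := eqP (valP K).
rewrite margin_adj_setD1 exchange_big /=.
have E y : y \in val K -> zero_ext (margin R n s s.+1 f) (val K :\ y)
   = f K + \sum_(x in ~: val K) zero_ext f ((x |: val K) :\ y).
  move=> yK; have c : #|val K :\ y| == s.
    by have := cK; rewrite (cardsD1 y) yK add1n => -[->].
  rewrite zero_extT margin_setU1 /= setCD [_ :|: [set y]]setUC big_setU1 /=; last first.
    by rewrite inE yK.
  rewrite setD1K // zero_ext_val; congr (_ + _); apply: eq_bigr => x.
  rewrite inE => xK; congr (zero_ext _ _); apply/setP => z; rewrite !inE.
  by case: eqVneq => [->|//]; case: eqVneq => [xy|//]; rewrite xy yK in xK.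
rewrite (eq_bigr _ E) big_split /= sumr_const cK.
by rewrite mulr_natl.
Qed.

(** The exchange sums agree, so only the diagonal counts n - (s+1) and s + 1 differ. *)
Lemma margin_margin_adj (s : nat) (f : V R n s.+1) : (2 * s.+1 <= n)%N ->
  margin R n s.+1 s.+2 (margin_adj R n s.+1 s.+2 f)
    = (n - 2 * s.+1)%:R *: f + margin_adj R n s s.+1 (margin R n s s.+1 f).
Proof.
move=> hn; apply/ffunP => K; rewrite !ffunE.
rewrite margin_margin_adj_setU1 margin_adj_margin_setD1 addrA; congr (_ + _).
rewrite -[_ *: _]/(_ * _) -mulrDl -natrD; congr (_%:R * _); lia.
Qed.

(* By [margin_margin_adj], [margin] composed with [margin_adj] is positive
   definite. *)
Lemma lker_margin_adj (s : nat) : (2 * s < n)%N ->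
  lker (margin_adj R n s s.+1) = 0%VS.
Proof.
move=> hn; apply/eqP; rewrite -subv0; apply/subvP => f; rewrite memv_ker memv0.
move=> /eqP f0; apply/eqP.
(* For [s = 0] there is no lower layer, but the exchange sum runs over points of the empty set, and
   only n times [f K] remains. *)
case: s hn f f0 => [|s] hn f f0.
  apply/ffunP => K; have := margin_margin_adj_setU1 f K.
  rewrite f0 linear0 [in X in _ + X]big1 => [|x _]; last first.
    by rewrite (cards0_eq (eqP (valP K))) big_set0.
  rewrite !ffunE addr0 subn0 => /esym/eqP; rewrite mulf_eq0 pnatr_eq0.
  by rewrite muln0 in hn; rewrite eqn0Ngt hn => /eqP.
have /(congr1 (dot f)) := margin_margin_adj f (ltnW hn).
rewrite f0 linear0 [LHS]dotC dot0l dotDr [dot f (_ *: _)]dotC dotZl.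
rewrite -margin_adjP => /esym/eqP.
rewrite paddr_eq0 ?dot_ge0 ?mulr_ge0 ?dot_ge0 //.
by case/andP; rewrite mulf_eq0 pnatr_eq0 subn_eq0 leqNgt hn => /eqP/dot_eq0.
Qed.

End Gottlieb.

(** * Dimensions of the layers *)

Lemma dim_rfun (R : realType) (T : finType) : \dim {:rfun R T} = #|T|.
Proof. by rewrite dimvf /dim /= muln1. Qed.

Lemma card_layer (n j : nat) : #|{: layer n j}| = 'C(n, j).
Proof. by rewrite card_sig -[n in RHS]card_ord -card_draws cardsE. Qed.

(** * U as a kernel operator *)

Section Decomposition.
Variables (R : realType) (n r : nat).

Lemma margin_id (A : V R n r) : margin R n r r A = A.
Proof.
apply/ffunP => J; rewrite marginE (big_pred1 J) // => I.
rewrite /= -val_eqE eq_sym eqEcard (eqP (valP I)) (eqP (valP J)) leqnn andbT //.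
Qed.

Lemma margin_adj_id (A : V R n r) : margin_adj R n r r A = A.
Proof.
apply/ffunP => J; rewrite margin_adjE (big_pred1 J) // => I.
rewrite /= -val_eqE eqEcard (eqP (valP I)) (eqP (valP J)) leqnn andbT //.
Qed.

(** After exchanging sums, a j-set below both I and I0 is a j-subset of their intersection. *)
Lemma UcenterE (A : V R n r) (I : layer n r) :
  Ucenter R n r A I
    = \sum_(I0 : layer n r) Ukernel R n r #|val I :&: val I0| * A I0.
Proof.
rewrite /Ucenter sum_lfunE sum_ffunE.
transitivity (\sum_(j < r.+1) \sum_(I0 : layer n r)
   Ucoef R n r j * 'C(#|val I :&: val I0|, j)%:R * A I0); last first.
  by rewrite exchange_big; apply: eq_bigr => I0 _; rewrite -mulr_suml.
apply: eq_bigr => j _; rewrite scale_lfunE ffunE comp_lfunE margin_adjE.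
under eq_bigr do rewrite marginE.
rewrite (exchange_big_dep xpredT) //= scaler_sumr; apply: eq_bigr => I0 _.
rewrite (sum_sigma (fun J : {set 'I_n} => #|J| == j)
  (fun J => (J \subset val I) && (J \subset val I0)) (fun=> A I0)).
rewrite -cards_draws cardsE sumr_const -mulrA mulr_natl -[LHS]/(_ * _).
congr (_ * (_ *+ _)).
by apply: eq_card => J; rewrite unfold_in [RHS]unfold_in subsetI andbC.
Qed.

End Decomposition.

(** * Projection, dimension and least squares *)

Section Projection.
Variables (R : realType) (n s : nat).
Local Notation r := s.+1.
Hypothesis hn : (2 * r <= n)%N.

Local Notation U := (Ucenter R n r).
Local Notation H := (residual_space R n r).
Local Notation L := (ANOVA_space R n r).

Lemma margin_Ucenter (A : V R n r) : margin R n s r (U A) = 0.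
Proof.
apply/ffunP => K; rewrite margin_setU1 [RHS]ffunE.
have cK := eqP (valP K).
transitivity (\sum_(x in ~: val K) \sum_(I0 : layer n r)
    Ukernel R n r #|(x |: val K) :&: val I0| * A I0).
  apply: eq_bigr => x; rewrite inE => xK.
  have c : #|x |: val K| == r by rewrite cardsU1 xK cK.
  by rewrite zero_extT UcenterE.
rewrite exchange_big big1 // => I0 _; rewrite -mulr_suml.
have cI := eqP (valP I0); set t := #|val K :&: val I0|.
have ts : (t <= s)%N by rewrite -cK subset_leq_card // subsetIl.
(* Adding x to K raises the overlap with I0 from t to t + 1 if x lies in I0, and leaves it at t
   otherwise. *)
rewrite (bigID (fun x => x \in val I0)) /=.
rewrite (eq_bigr (fun=> Ukernel R n r t.+1)) => [|x /andP[xK xI]]; last first.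
  rewrite setIUl (setIidPl _) ?sub1set // cardsU1 !inE.
  by rewrite inE in xK; rewrite (negPf xK).
rewrite [X in _ + X](eq_bigr (fun=> Ukernel R n r t)) => [|x /andP[xK xI]]; last first.
  congr (Ukernel R n r #|pred_of_set _|); apply/setP => y; rewrite !inE.
  by case: eqVneq => // ->; rewrite (negPf xI) !andbF.
rewrite (eq_bigl (mem (val I0 :\: val K))) => [|x]; last by rewrite !inE.
rewrite [X in _ + X](eq_bigl (mem (~: (val K :|: val I0)))) => [|x]; last first.
  by rewrite !inE negb_or.
rewrite !sumr_const cardsD setIC cI -/t.
(* The union has s + r - t = 2r - 1 - t points. *)
have -> : #|~: (val K :|: val I0)| = (n - 2 * r + 1 + t)%N.
  by rewrite cardsCs setCK cardsU cK cI card_ord -/t; lia.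
rewrite -[_ *+ (r - t)]mulr_natl -[_ *+ (_ + t)]mulr_natl natrB; last by lia.
by rewrite !natrD natrB // natrM Ukernel_rec ?mul0r.
Qed.

Lemma Ucenter_residual (A : V R n r) : U A \in H.
Proof. by rewrite memv_ker margin_Ucenter. Qed.

(** The factor r - j in [margin_adj_comp] is nonzero for j < r and can be divided out. *)
Lemma margin_adj_ANOVA (j : nat) (f : V R n j) : (j <= s)%N ->
  margin_adj R n j r f \in L.
Proof.
move=> js; have := margin_adj_comp f (leqW js).
have d0 : ((r - j)%:R : R) != 0 by rewrite pnatr_eq0 subn_eq0 -ltnNge.
move=> /(congr1 ( *:%R (r - j)%:R^-1)); rewrite scalerA mulVf // scale1r => <-.
by rewrite memvZ // memv_img // memvf.
Qed.

Lemma sub_Ucenter_ANOVA (A : V R n r) : A - U A \in L.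
Proof.
rewrite /Ucenter sum_lfunE big_ord_recr /= scale_lfunE comp_lfunE.
rewrite margin_id margin_adj_id /Ucoef subnn bin0 expr0 divr1 scale1r.
rewrite opprD addrCA subrr addr0 memvN memv_suml // => j _.
by rewrite scale_lfunE comp_lfunE memvZ // margin_adj_ANOVA // -ltnS.
Qed.

Lemma residual_ANOVA_dot0 (A B : V R n r) : A \in H -> B \in L -> dot A B = 0.
Proof.
rewrite memv_ker => /eqP A0 /memv_imgP[f _ ->].
by rewrite -margin_adjP A0 dot0l.
Qed.

Lemma residual_ANOVA_eq0 (A : V R n r) : A \in H -> A \in L -> A = 0.
Proof. by move=> AH AL; apply: dot_eq0; apply: residual_ANOVA_dot0. Qed.

Lemma Ucenter_id (A : V R n r) : A \in H -> U A = A.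
Proof.
move=> AH; apply/esym/subr0_eq; apply: residual_ANOVA_eq0.
  by rewrite memvB ?Ucenter_residual.
exact: sub_Ucenter_ANOVA.
Qed.

(** [B - U B] lies in L, hence is orthogonal to [U A]. The right side is symmetric in A and B, which
    yields self-adjointness. *)
Lemma dot_Ucenterl (A B : V R n r) : dot (U A) B = dot (U A) (U B).
Proof.
rewrite -{1}(subrK (U B) B) dotDr residual_ANOVA_dot0 ?add0r //.
  exact: Ucenter_residual.
exact: sub_Ucenter_ANOVA.
Qed.

Lemma Ucenter_selfadjoint (A B : V R n r) : dot (U A) B = dot A (U B).
Proof. by rewrite dot_Ucenterl [RHS]dotC [RHS]dot_Ucenterl dotC. Qed.

Lemma lker_Ucenter : lker U = L.
Proof.
apply/vspaceP => A; rewrite memv_ker; apply/eqP/idP => [A0|AL].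
  by have := sub_Ucenter_ANOVA A; rewrite A0 subr0.
(* For A in L, [U A] is the difference of A and [A - U A], both in L. *)
apply: residual_ANOVA_eq0; first exact: Ucenter_residual.
by have := memvB AL (sub_Ucenter_ANOVA A); rewrite opprB addrCA subrr addr0.
Qed.

Lemma limg_Ucenter : limg U = H.
Proof.
apply/vspaceP => A; apply/memv_imgP/idP => [[B _ ->]|AH].
  exact: Ucenter_residual.
by exists A; rewrite ?memvf ?Ucenter_id.
Qed.

Lemma dim_ANOVA : \dim L = 'C(n, s).
Proof.
rewrite limg_dim_eq ?dim_rfun ?card_layer //.
by rewrite lker_margin_adj ?capv0 //; lia.
Qed.

(** Rank-nullity for U, in additive form to avoid truncated subtraction. *)
Lemma dim_residual : (\dim H + 'C(n, s) = 'C(n, r))%N.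
Proof.
rewrite -dim_ANOVA -lker_Ucenter -limg_Ucenter addnC.
have := limg_ker_dim U fullv; rewrite capfv => ->.
by rewrite dim_rfun card_layer.
Qed.

(** Groups the parameters by layer; the bound on [#|J|] is automatic there since j < r. *)
Lemma ANOVA_fit_sum (alpha : effects R n r) :
  ANOVA_fit alpha
    = \sum_(j < r) margin_adj R n j r [ffun J : layer n j => zero_ext alpha (val J)].
Proof.
apply/ffunP => I; rewrite ffunE sum_ffunE; apply: eq_bigr => j _.
rewrite margin_adjE; under [RHS]eq_bigr do rewrite ffunE.
rewrite (sum_sigma (fun J : {set 'I_n} => #|J| == j)
  (fun J : {set 'I_n} => J \subset val I) (zero_ext alpha)).
rewrite (sum_zero_ext (fun J : {set 'I_n} => (J \subset val I) && (#|J| == j))).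
apply: eq_bigl => J; case: eqP => [->|_]; last by rewrite !andbF.
by rewrite ltn_ord andbT.
Qed.

Lemma ANOVA_fit_in (alpha : effects R n r) : ANOVA_fit alpha \in L.
Proof.
rewrite ANOVA_fit_sum memv_suml // => j _.
by rewrite margin_adj_ANOVA // -ltnS.
Qed.

(** Effects of order s suffice: the witness is f on layer s and zero on smaller sets. *)
Lemma ANOVA_fit_onto (B : V R n r) : B \in L ->
  exists alpha : effects R n r, ANOVA_fit alpha = B.
Proof.
case/memv_imgP => f _ ->.
exists [ffun J => zero_ext f (val J)]; rewrite ANOVA_fit_sum big_ord_recr /=.
rewrite big1 ?add0r => [|j _].
  congr (margin_adj _ _ _ _ _); apply/ffunP => J; rewrite ffunE.
  have JP : (#|val J| < r)%N by rewrite (eqP (valP J)).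
  by rewrite zero_extT ffunE zero_ext_val.
rewrite (_ : [ffun J => _] = 0) ?linear0 //; apply/ffunP => J; rewrite !ffunE.
have JP : (#|val J| < r)%N by rewrite (eqP (valP J)) ltnW // ltnS.
by rewrite zero_extT ffunE zero_extN // (eqP (valP J)) ltn_eqF.
Qed.

(** Pythagoras for the H and L components of [A - B]. *)
Lemma dot_sub_ANOVA (A B : V R n r) : B \in L ->
  dot (A - B) (A - B) = dot (U A) (U A) + dot (A - U A - B) (A - U A - B).
Proof.
move=> BL; set C := A - U A - B.
have CL : C \in L by rewrite memvB // sub_Ucenter_ANOVA.
have -> : A - B = U A + C by rewrite /C addrA [U A + _]addrC subrK.
have UC : dot (U A) C = 0 by rewrite residual_ANOVA_dot0 ?Ucenter_residual.
by clearbody C; rewrite dotDl !dotDr [dot C (U A)]dotC UC addr0 add0r.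
Qed.

(** In [dot_sub_ANOVA] only the second term depends on the fit. It vanishes exactly when the fit is
    [A - U A], which [ANOVA_fit_onto] attains. *)
Lemma least_squares_Ucenter (A E : V R n r) :
  least_squares_residual A E <-> E = U A.
Proof.
have [alpha fitA] := ANOVA_fit_onto (sub_Ucenter_ANOVA A).
split=> [[beta [min ->]]|->]; last first.
  exists alpha; rewrite fitA subKr; split=> // beta.
  by rewrite (dot_sub_ANOVA A (ANOVA_fit_in beta)) lerDl dot_ge0.
have := min alpha; rewrite fitA subKr (dot_sub_ANOVA A (ANOVA_fit_in beta)).
rewrite gerDl => d0; have /dot_eq0/subr0_eq <- : dot (A - U A - ANOVA_fit beta)
    (A - U A - ANOVA_fit beta) = 0 by apply/eqP; rewrite eq_le d0 dot_ge0.
by rewrite subKr.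
Qed.

End Projection.

Theorem theorem5p2 (R : realType) (n r : nat)
    (hr : (1 <= r)%N) (hn : (2 * r <= n)%N) :
  orthogonal_projection (Ucenter R n r) (residual_space R n r) /\
  (forall A E : V R n r, least_squares_residual A E <-> E = Ucenter R n r A) /\
  (forall A : V R n r, margin R n r.-1 r (Ucenter R n r A) = 0) /\
  (forall A : V R n r, A \in residual_space R n r -> Ucenter R n r A = A) /\
  ((forall A B : V R n r,
      dot (Ucenter R n r A) B = dot A (Ucenter R n r B)) /\
   (forall A : V R n r, Ucenter R n r (Ucenter R n r A) = Ucenter R n r A)) /\
  lker (Ucenter R n r) = ANOVA_space R n r /\
  ((\dim (residual_space R n r))%:R = 'C(n, r)%:R - 'C(n, r.-1)%:R :> R /\
   'C(n, r)%:R - 'C(n, r.-1)%:R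
     = 'C(n, r)%:R * ((n%:R - 2 * r%:R + 1) / (n%:R - r%:R + 1)) :> R).
Proof.
case: r hr hn => // s _ hn'.
split.
  move=> A; split; first exact: Ucenter_residual.
  by move=> B BH; rewrite dotC residual_ANOVA_dot0 ?sub_Ucenter_ANOVA.
split; first exact: least_squares_Ucenter.
split; first exact: margin_Ucenter.
split; first exact: Ucenter_id.
split.
  split; first exact: Ucenter_selfadjoint.
  by move=> A; rewrite Ucenter_id ?Ucenter_residual.
split; first exact: lker_Ucenter.
rewrite -(dim_residual R hn') natrD addrK; split=> //=.
(* With r = s + 1 this is r C(n,r) = (n-r+1) C(n,r-1), which gives the product formula once the
   denominator n - r + 1 is cleared. *)
have := natr_mul_bin_left R n s.
have D0 : n%:R - s.+1%:R + 1 != 0 :> R.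
  by rewrite -natrB ?natr1 ?pnatr_eq0 //; lia.
rewrite -(dim_residual R hn') natrD.
move: D0; rewrite -natr1 => D0 E.
apply: (mulIf D0); rewrite -[RHS]mulrA divfK //.
apply: subr0_eq; move/eqP: E; rewrite -subr_eq0 => /eqP <-; ring.
Qed.
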